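(* Let $M_k$ be the submatrix of $M$ consisting of the rows indexed by the working set $\mathcal{W}_k$. Assume that there exist $L$ and $D$ such that $M_k M_k^T = L D L^T$, with $L$ being a lower unit triangular matrix and $D$ being a diagonal matrix with nonnegative elements. Then $[D]_{ii} \neq 0$ for all $i$ if and only if $M_k M_k^T$ is nonsingular.
   Context: Let $H\in\mathbb{R}^{n\times n}$ be symmetric positive definite, $A\in\mathbb{R}^{m\times n}$, let $R$ be an upper triangular Cholesky factor of $H$ (so $H=R^TR$), and set $M = A R^{-1}\in\mathbb{R}^{m\times n}$. The working set $\mathcal{W}_k\subseteq\{1,\dots,m\}$ is an arbitrary set of row indices, and $M_k$ denotes the matrix formed by the rows of $M$ indexed by $\mathcal{W}_k$ (in some fixed order). ''Lower unit triangular'' means lower triangular with all diagonal entries equal to $1$. $L$ and $D$ are real square matrices of the same size as $M_kM_k^T$, and $[D]_{ii}$ is the $i$th diagonal entry of $D$. *)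

(* Defs.v *)
From HB Require Import structures.
From mathcomp Require Import all_boot all_order all_algebra.
From mathcomp Require Import reals.

Set Implicit Arguments.
Unset Strict Implicit.
Unset Printing Implicit Defensive.

Import Order.TTheory GRing.Theory Num.Theory.

Local Open Scope ring_scope.

Definition posdefmx (F : realType) (n : nat) (H : 'M[F]_n) : Prop :=
  H \is symmetricmx /\
  forall x : 'cV[F]_n, x != 0 -> 0 < (x^T *m H *m x) 0 0.

(* [is_trig_mx] is lower triangularity. *)
Definition upper_trig_mx (F : realType) (n : nat) (A : 'M[F]_n) : Prop :=
  is_trig_mx A^T.

Definition lower_unit_trig_mx (F : realType) (p : nat) (L : 'M[F]_p) : Prop :=
  is_trig_mx L /\ forall i, L i i = 1.

(* No sign condition is imposed on the diagonal of the Cholesky factor. *)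
Definition cholesky_factor (F : realType) (n : nat) (H R : 'M[F]_n) : Prop :=
  upper_trig_mx R /\ H = R^T *m R.

(* [w] lists the elements of [W] without repetition, in an arbitrary order. *)
Definition enumerates (m p : nat) (w : 'I_p -> 'I_m) (W : {set 'I_m}) : Prop :=
  injective w /\ W = [set w i | i : 'I_p].

(* Main.v *)
Require Import Defs.
From HB Require Import structures.
From mathcomp Require Import all_boot all_order all_algebra.
From mathcomp Require Import reals.

Import Order.TTheory GRing.Theory Num.Theory.

Local Open Scope ring_scope.

(** Everything is read off determinants. A unit triangular [L] has determinant 1, so
    multiplicativity applied to the factorization gives [\det (Mk *m Mk^T) = \det D], which is the
    product of the diagonal entries of [D]. Over a field, a matrix is invertible iff its determinant
    is nonzero, and a finite product is nonzero iff each of its factors is. *)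

Lemma det_lower_unit_trig {F : realType} {p : nat} {L : 'M[F]_p} :
  lower_unit_trig_mx L -> \det L = 1.
Proof. by case=> L_trig L1; rewrite det_trig // big1. Qed.

Theorem lemma1 (F : realType) (m n : nat)
    (H : 'M[F]_n) (A : 'M[F]_(m, n)) (R : 'M[F]_n) (M : 'M[F]_(m, n))
    (W : {set 'I_m}) (p : nat) (w : 'I_p -> 'I_m) (Mk : 'M[F]_(p, n))
    (L D : 'M[F]_p)
    (H_posdef : posdefmx H)
    (R_chol : cholesky_factor H R)
    (M_def : M = A *m invmx R)
    (w_enum : enumerates w W)
    (Mk_def : Mk = rowsub w M)
    (L_unit : lower_unit_trig_mx L)
    (D_diag : is_diag_mx D)
    (D_ge0 : forall i, 0 <= D i i)
    (LDL : Mk *m Mk^T = L *m D *m L^T) :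
  (forall i, D i i != 0) <-> Mk *m Mk^T \in unitmx.
Proof.
have detMM : \det (Mk *m Mk^T) = \prod_i D i i.
  rewrite LDL !det_mulmx det_tr (det_lower_unit_trig L_unit) mul1r mulr1.
  (* Only [\det D] is left; a diagonal matrix is in particular triangular. *)
  exact/det_trig/is_diag_mx_is_trig.
rewrite unitmxE detMM unitfE; split=> [D_neq0|/prodf_neq0 D_neq0 i].
  by apply/prodf_neq0 => i _.
exact: D_neq0.
Qed.
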